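(* Let $G$ be a graph and let $H$ be a non-trivial induced subgraph of $G$. Then: (1) $\rho(I(H))\le\rho(I(G))$. (2) $\rho_a(I(H))\le\rho_a(I(G))$.
   Context: All graphs are finite and simple; non-trivial means having at least one edge. The edge ideal $I(G)$, over a field $\mathbb{K}$, is the ideal of $\mathbb{K}[x : x\in V(G)]$ generated by $\{xy : \{x,y\}\in E(G)\}$. For an ideal $I$ in a Noetherian ring $R$, $I^{(s)}=\bigcap_{P\in\mathrm{Ass}(I)}(I^sR_P\cap R)$ is the $s$-th symbolic power. The resurgence and asymptotic resurgence are $\rho(I)=\sup\{s/t : s,t\in\mathbb{N},\ I^{(s)}\not\subset I^t\}$ and $\rho_a(I)=\sup\{s/t : s,t\in\mathbb{N},\ I^{(sr)}\not\subset I^{tr}\text{ for all } r\gg0\}$, where $\mathbb{N}$ denotes the positive integers. *)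

(* Defs.v *)
(* The notations of mpoly conflict with those of ereal, and it is loaded first
   because it defines its own symmetric. *)
From mathcomp Require Import -(notations) mpoly.
From mathcomp Require Import all_boot all_order all_algebra.
From mathcomp Require Import boolp classical_sets reals ereal.

Set Implicit Arguments.
Unset Strict Implicit.
Unset Printing Implicit Defensive.

Import Order.TTheory GRing.Theory Num.Theory.
Local Open Scope classical_set_scope.
Local Open Scope ring_scope.

Record sgraph := SGraph {
  vertex :> finType;
  edge : rel vertex;
  edge_sym : symmetric edge;
  edge_irrefl : irreflexive edge }.

Definition nontrivial (G : sgraph) : Prop := exists x y : G, edge x y.

Section Induced.
Context (G : sgraph) (W : {set G}).

Definition induced_edge : rel {x : G | x \in W} :=
  fun x y => edge (val x) (val y).

Lemma induced_edge_sym : symmetric induced_edge.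
Proof. by move=> x y; exact: edge_sym. Qed.

Lemma induced_edge_irrefl : irreflexive induced_edge.
Proof. by move=> x; exact: edge_irrefl. Qed.

Definition induced : sgraph := SGraph induced_edge_sym induced_edge_irrefl.

End Induced.

Section Ideals.
Context (A : comNzRingType).

(* The S-submodule of A generated by X, when S is a subring of A. *)
Definition lin_span (S X : set A) : set A :=
  [set f | exists2 s : seq (A * A),
     forall p, p \in s -> S p.1 /\ X p.2 & f = \sum_(p <- s) p.1 * p.2].

Definition ideal_gen (X : set A) : set A := lin_span setT X.

Definition ideal_pow (I : set A) (t : nat) : set A :=
  ideal_gen [set f | exists2 a : 'I_t -> A,
               forall i, I (a i) & f = \prod_(i < t) a i].

(* idealr_closed includes that the ideal is proper *)
Definition is_prime_ideal (P : set A) : Prop :=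
  idealr_closed [in P] /\ prime_idealr_closed [in P].

(* The associated primes of the module A / I, i.e. the prime ideals that are
   the annihilator (I : f) of the class of some f. *)
Definition Ass (I : set A) : set (set A) :=
  [set P | is_prime_ideal P /\ exists f, P = [set g | I (g * f)]].

End Ideals.

Section Symbolic.
Context (A : idomainType).

(* Since A is a domain, its localization A_P at a prime P is taken inside
   Frac(A); a denominator b outside P is nonzero because P contains 0. *)
Definition localization (P : set A) : set {fraction A} :=
  [set x | exists a b, ~ P b /\ x = tofrac a / tofrac b].

Definition local_ext (P J : set A) : set {fraction A} :=
  lin_span (localization P) (@tofrac A @` J).

Definition symbolic_pow (I : set A) (s : nat) : set A :=
  \bigcap_(P in Ass I) [set f | local_ext P (ideal_pow I s) (tofrac f)].

Context (R : realType).

Definition resurgence (I : set A) : \bar R :=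
  ereal_sup [set x | exists s t : nat,
    [/\ (0 < s)%N, (0 < t)%N, ~ (symbolic_pow I s `<=` ideal_pow I t)
      & x = (s%:R / t%:R)%:E]].

Definition asymptotic_resurgence (I : set A) : \bar R :=
  ereal_sup [set x | exists s t : nat,
    [/\ (0 < s)%N, (0 < t)%N,
        exists N : nat, forall r : nat, (N <= r)%N ->
          ~ (symbolic_pow I (s * r) `<=` ideal_pow I (t * r))
      & x = (s%:R / t%:R)%:E]].

End Symbolic.

Section EdgeIdeal.
Context (K : fieldType) (G : sgraph).

(* K[x : x in V(G)], the variable of the vertex x being 'X_(enum_rank x) *)
Definition vertex_ring : idomainType := mpoly #|G| K.

Definition vertex_var (x : G) : vertex_ring :=
  mpolyX K (mnm1 (enum_rank x)).

Definition edge_ideal : set vertex_ring :=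
  ideal_gen [set f | exists x y : G,
               edge x y /\ f = vertex_var x * vertex_var y].

End EdgeIdeal.

Arguments vertex_var : clear implicits.
Arguments edge_ideal : clear implicits.

(* Main.v *)
Require Import Defs.
From mathcomp Require Import -(notations) mpoly.
From mathcomp Require Import all_boot all_order all_algebra.
From mathcomp Require Import boolp classical_sets reals ereal.
From mathcomp Require Import ring.

Set Implicit Arguments.
Unset Strict Implicit.
Unset Printing Implicit Defensive.

Import GRing.Theory.
Local Open Scope classical_set_scope.
Local Open Scope ring_scope.

(** Write [H] for the induced subgraph on [W].  Both inequalities are suprema
    over sets of pairs [s, t], so it is enough that
    [I(G)^(s) <= I(G)^t] implies [I(H)^(s) <= I(H)^t] for all [s] and [t]
    ([induced_containment]).  The polynomial ring of [H] embeds in that of [G]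
    ([extend]), with the retraction [restrict] that kills the variables
    outside [W].  As [H] is induced, [restrict] maps [I(G)] into [I(H)], hence
    [I(G)^t] into [I(H)^t].  What remains is that [extend] maps [I(H)^(s)]
    into [I(G)^(s)] ([extend_symbolic_pow]).

    Let [P] be an associated prime of [I(G)] and [C] the set of the vertices
    whose variables lie in [P].  It is a vertex cover in which each vertex has
    a neighbor outside [C] ([Ass_neighbor]), so each variable of [C] lies in
    the localization of [I(G)] at [P]: the neighbor's variable is a unit
    there.  Concretely, with [D] the product of the variables outside [C], a
    product of [s] variables of [C] times [D ^+ s] is in [I(G)^s].

    The trace of [C] on [H] is a vertex cover of [H], perhaps not a minimal
    one, so it need not give an associated prime of [I(H)]; but it contains a
    minimal cover [C'], which does ([minimal_cover_Ass]).  If [f] is in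
    [I(H)^(s)], some [b] outside the prime [(C')] has [b * f] in [I(H)^s], so
    [b * f] vanishes to order [s] along the coordinate subspace where the
    variables of [C'] are zero.  The order of vanishing is a valuation
    ([vanish_cancel]), so [f] itself vanishes to order [s]: it is in
    [(C')^s].  Then [extend f * D ^+ s] is in [I(G)^s], and [D ^+ s] is not in
    [P]. *)

(** * Ideals, their powers and prime ideals *)

Section Ideals.
Context (A : comNzRingType).
Implicit Types (I J X : set A) (a x y : A) (t : nat).

Definition is_ideal J : Prop :=
  [/\ J 0, forall x y, J x -> J y -> J (x + y) & forall a x, J x -> J (a * x)].

Lemma ideal_sum J (T : eqType) (r : seq T) (F : T -> A) :
  is_ideal J -> (forall i, i \in r -> J (F i)) -> J (\sum_(i <- r) F i).
Proof. by case=> J0 JD _ JF; rewrite big_seq; elim/big_ind: _. Qed.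

Lemma ideal_gen_ideal X : is_ideal (ideal_gen X).
Proof.
split=> [|x y [r Xr ->] [r' Xr' ->]|a x [r Xr ->]].
- by exists [::]; rewrite ?big_nil.
- exists (r ++ r'); last by rewrite big_cat.
  by move=> p; rewrite mem_cat => /orP[/Xr|/Xr'].
- exists [seq (a * p.1, p.2) | p <- r].
    by move=> _ /mapP[p /Xr[_ Xp] ->].
  by rewrite big_map mulr_sumr; apply: eq_bigr => p _; rewrite mulrA.
Qed.

Lemma sub_ideal_gen X : X `<=` ideal_gen X.
Proof.
move=> x Xx; exists [:: (1, x)]; last by rewrite big_seq1 mul1r.
by move=> p; rewrite inE => /eqP->.
Qed.

Lemma ideal_gen_min X J : is_ideal J -> X `<=` J -> ideal_gen X `<=` J.
Proof.
move=> idJ XJ x [r Xr ->]; have [_ _ JM] := idJ.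
by apply: ideal_sum => // p /Xr[_ /XJ/JM].
Qed.

Lemma ideal_pow_prod I t (a : 'I_t -> A) :
  (forall i, I (a i)) -> ideal_pow I t (\prod_(i < t) a i).
Proof. by move=> Ia; apply: sub_ideal_gen; exists a. Qed.

Lemma ideal_pow_min I J t : is_ideal J ->
  (forall a : 'I_t -> A, (forall i, I (a i)) -> J (\prod_(i < t) a i)) ->
  ideal_pow I t `<=` J.
Proof. by move=> idJ IJ; apply: ideal_gen_min => // _ [a Ia ->]; apply: IJ. Qed.

Lemma ideal_pow0 I x : ideal_pow I 0 x.
Proof.
have [_ _ IM] : is_ideal (ideal_pow I 0) by exact: ideal_gen_ideal.
rewrite -[x]mulr1; apply: IM.
have <- : \prod_(i < 0) (0 : A) = 1 by rewrite big_ord0.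
by apply: ideal_pow_prod => -[].
Qed.

Lemma ideal_pow1_sub I : is_ideal I -> ideal_pow I 1 `<=` I.
Proof. by move=> idI; apply: ideal_pow_min => // a Ia; rewrite big_ord1. Qed.

Lemma ideal_powS I t x y : I x -> ideal_pow I t y -> ideal_pow I t.+1 (x * y).
Proof.
move=> Ix; move: y.
have [I0 ID IM] : is_ideal (ideal_pow I t.+1) by exact: ideal_gen_ideal.
apply: (@ideal_pow_min I (fun y => ideal_pow I t.+1 (x * y))) => [|a Ia].
  split=> [|y z Iy Iz|b y Iy]; first by rewrite mulr0.
  - by rewrite mulrDr; apply: ID.
  - by rewrite mulrCA; apply: IM.
pose c i := if unlift ord0 i is Some j then a j else x.
have -> : x * \prod_(i < t) a i = \prod_(i < t.+1) c i.
  rewrite big_ord_recl /c unlift_none; congr (_ * _).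
  by apply: eq_bigr => i _; rewrite liftK.
by apply: ideal_pow_prod => i; rewrite /c; case: unlift.
Qed.

End Ideals.

(** The factor [D] lets the image of [I] lie in [J] only after localization at
    [D]; [D = 1] is the plain functoriality of powers. *)
Lemma ideal_pow_morph (A B : comNzRingType) (psi : {rmorphism A -> B})
    (I : set A) (J : set B) (D : B) (t : nat) (x : A) :
  (forall a, I a -> J (psi a * D)) ->
  ideal_pow I t x -> ideal_pow J t (psi x * D ^+ t).
Proof.
move=> IJ; move: x.
have [J0 JD JM] : is_ideal (ideal_pow J t) by exact: ideal_gen_ideal.
apply: (@ideal_pow_min A I (fun x => ideal_pow J t (psi x * D ^+ t))).
  split=> [|x y Jx Jy|a x Jx]; first by rewrite rmorph0 mul0r.
  - by rewrite rmorphD mulrDl; apply: JD.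
  - by rewrite rmorphM -mulrA; apply: JM.
move=> a Ia; rewrite rmorph_prod -[in D ^+ t](card_ord t) -prodr_const.
by rewrite -big_split; apply: ideal_pow_prod => i; apply: IJ.
Qed.

Section PrimeIdeal.
Context (A : comNzRingType) (P : set A) (primeP : is_prime_ideal P).

Lemma prime_ideal0 : P 0.
Proof. by case: primeP => -[]; rewrite inE. Qed.

Lemma prime_ideal1 : ~ P 1.
Proof. by case: primeP => -[_ /negP + _] _; rewrite inE. Qed.

Lemma prime_idealM x y : P (x * y) -> P x \/ P y.
Proof.
case: primeP => _ pP Pxy; have := pP x y.
by rewrite !inE => /(_ Pxy)/orP[]; rewrite inE; [left|right].
Qed.

Lemma prime_idealM_not x y : ~ P x -> ~ P y -> ~ P (x * y).
Proof. by move=> Px Py /prime_idealM[]. Qed.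

Lemma prime_ideal_prod_not (T : finType) (Q : pred T) (F : T -> A) :
  (forall i, Q i -> ~ P (F i)) -> ~ P (\prod_(i | Q i) F i).
Proof.
by move=> PF; elim/big_rec: _ => [|i x /PF Pi Px]; [exact: prime_ideal1|
  exact: prime_idealM_not].
Qed.

Lemma prime_idealX_not x t : ~ P x -> ~ P (x ^+ t).
Proof.
move=> Px; elim: t => [|t IH]; first by rewrite expr0; exact: prime_ideal1.
by rewrite exprS; exact: prime_idealM_not.
Qed.

End PrimeIdeal.

(** * Membership in a localized ideal *)

Lemma addr_fracM (F : fieldType) (b v u k j : F) : b != 0 -> v != 0 ->
  u / v * k + j / b = (b * u * k + v * j) / (v * b).
Proof. by move=> b0 v0; field; rewrite b0 v0. Qed.

Section Localization.
Context (A : idomainType).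

(** Clearing denominators: a finite sum of fractions has a common denominator
    outside the prime [P], as the complement of [P] is multiplicative. *)
Lemma local_ext_tofracP (P J : set A) (f : A) :
  is_prime_ideal P -> is_ideal J ->
  local_ext P J (tofrac f) <-> exists2 b, ~ P b & J (b * f).
Proof.
move=> pP [J0 JD JM].
have nz b : ~ P b -> tofrac b != 0 :> {fraction A}.
  move=> Pb; rewrite tofrac_eq0; apply/eqP => b0; apply: Pb; rewrite b0.
  exact: prime_ideal0.
split=> [[r Jr eqf]|[b Pb Jbf]]; last first.
  exists [:: (tofrac 1 / tofrac b, tofrac (b * f))].
    move=> p; rewrite inE => /eqP->; split; first by exists 1, b.
    by exists (b * f).
  by rewrite big_seq1 /= tofrac1 mul1r tofracM mulKf ?nz.
suff [b Pb [j Jj eqj]] : exists2 b, ~ P b & exists2 j, J j &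
    \sum_(p <- r) p.1 * p.2 = tofrac j / tofrac b.
  exists b => //; suff -> : b * f = j by [].
  apply/eqP; rewrite -tofrac_eq tofracM eqf eqj mulrC divfK //; exact: nz.
elim: r Jr {eqf} => [|p r IH] Jr.
  exists 1; first exact: prime_ideal1.
  by exists 0 => //; rewrite big_nil tofrac0 mul0r.
have [|b Pb [j Jj eqj]] := IH.
  by move=> q qr; apply: Jr; rewrite inE qr orbT.
have [[u [v [Pv eq1]]] [k Jk eq2]] := Jr p (mem_head _ _).
exists (v * b); first exact: prime_idealM_not.
exists (b * u * k + v * j); first by apply: JD; apply: JM.
rewrite big_cons eqj eq1 -eq2 !tofracD !tofracM.
by apply: addr_fracM; rewrite nz.
Qed.

End Localization.

(** * Order of vanishing along a coordinate subspace *)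

Section Vanishing.
Context (K : fieldType) (n : nat) (C : {set 'I_n}).
Implicit Types (m : multinom n) (f b : mpoly n K) (d : nat).

Definition wdeg m : nat := \sum_(i in C) m i.

Lemma wdegD m1 m2 : wdeg (mnm_add m1 m2) = (wdeg m1 + wdeg m2)%N.
Proof. by rewrite /wdeg -big_split; apply: eq_bigr => i _; rewrite mnmDE. Qed.

Lemma wdeg1 i : wdeg (mnm1 i) = (i \in C).
Proof.
rewrite /wdeg; under eq_bigr do rewrite mnm1E.
case: (boolP (i \in C)) => iC.
  rewrite (bigD1 i) //= eqxx big1 // => j /andP[_ /negPf].
  by rewrite eq_sym => ->.
by rewrite big1 // => j jC; case: eqP iC => // ->; rewrite jC.
Qed.

Lemma wdeg_gt0P m : reflect (exists2 i, i \in C & (0 < m i)%N) (0 < wdeg m)%N.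
Proof.
rewrite lt0n sum_nat_eq0 negb_forall; apply: (iffP existsP) => -[i].
  by rewrite negb_imply -lt0n => /andP[]; exists i.
by move=> iC mi; exists i; rewrite negb_imply iC -lt0n.
Qed.

(** The polynomials of order of vanishing at least [d] along the subspace where
    the variables of [C] are zero, i.e. the [d]-th power of the ideal generated
    by these variables. *)
Definition vanish d : set (mpoly n K) :=
  [set f | forall m, m \in msupp f -> (d <= wdeg m)%N].

Lemma vanishM d e f g : vanish d f -> vanish e g -> vanish (d + e) (f * g).
Proof.
move=> vf vg m /msuppM_le/allpairsP[[m1 m2] /= [/vf m1d /vg m2e ->]].
by rewrite wdegD leq_add.
Qed.

Lemma vanish_leq d e f : (d <= e)%N -> vanish e f -> vanish d f.
Proof. by move=> de vf m /vf; apply: leq_trans. Qed.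

Lemma vanish_ideal d : is_ideal (vanish d).
Proof.
split=> [m|f g vf vg m /msuppD_le|b f vf]; first by rewrite msupp0.
  by rewrite mem_cat => /orP[/vf|/vg].
by rewrite -[d]add0n; apply: vanishM.
Qed.

Lemma vanish_prod t (F : 'I_t -> mpoly n K) :
  (forall i, vanish 1 (F i)) -> vanish t (\prod_(i < t) F i).
Proof.
elim: t F => [|t IH] F vF; first by move=> m _.
by rewrite big_ord_recl; apply: (@vanishM 1 t) => //; apply: IH.
Qed.

Definition wpart d f : mpoly n K :=
  \sum_(m <- msupp f | wdeg m == d) mcoeff m f *: mpolyX K m.

Lemma mcoeff_wpart d f m :
  mcoeff m (wpart d f) = if wdeg m == d then mcoeff m f else 0.
Proof.
rewrite /wpart linear_sum /= big_mkcond.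
under eq_bigr do rewrite linearZ /= mcoeffX.
have [mf|mf] := boolP (m \in msupp f).
  rewrite (bigD1_seq m) ?msupp_uniq //= eqxx mulr1 big1 ?addr0 // => k /negPf->.
  by rewrite mulr0 if_same.
rewrite (memN_msupp_eq0 mf) if_same big_seq big1 // => k kf.
by case: (k =P m) kf mf => [->->|_ _ _] //; rewrite mulr0 if_same.
Qed.

Lemma wpart_supp d f m : m \in msupp (wpart d f) -> wdeg m = d.
Proof.
by rewrite mcoeff_msupp mcoeff_wpart; case: (wdeg m =P d); rewrite ?eqxx.
Qed.

Lemma vanish_sub_wpart d f : vanish d f -> vanish d.+1 (f - wpart d f).
Proof.
move=> vf m; rewrite mcoeff_msupp mcoeffB mcoeff_wpart ltn_neqAle.
case: (wdeg m =P d) => [_|/eqP]; first by rewrite subrr eqxx.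
by rewrite subr0 -mcoeff_msupp eq_sym => -> /vf.
Qed.

(** The lowest-degree parts of [b] and [f] for the grading [wdeg] multiply to
    the lowest-degree part of [b * f], which is nonzero as the ring is a
    domain.  So if [b] has a part of degree [0], the order of [b * f] is that
    of [f].  For [d = 1] this is the primality of the ideal [(C)], for general
    [d] it says that the powers of [(C)] are primary. *)
Lemma vanish_cancel d b f : ~ vanish 1 b -> vanish d (b * f) -> vanish d f.
Proof.
move=> vb; elim: d => [|d IH] vbf; first by move=> m _.
have vf : vanish d f by apply: IH; apply: vanish_leq vbf.
have [_ vD vM] := vanish_ideal d.+1.
pose b0 := wpart 0 b; pose f0 := wpart d f.
have vb1 : vanish 1 (b - b0) by apply: vanish_sub_wpart => m _.
have vf1 : vanish d.+1 (f - f0) by exact: vanish_sub_wpart.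
have v00 : vanish d.+1 (b0 * f0).
  (* Every summand on the right has order at least [d.+1]: the first by
     hypothesis, the others since a lowest part has been subtracted. *)
  have -> : b0 * f0 = b * f + (- 1 * ((b - b0) * f) + - b0 * (f - f0)).
    by ring.
  apply: (vD _ _ vbf); apply: (vD); apply: vM => //.
  exact: (@vanishM 1 d).
have : b0 * f0 == 0.
  rewrite -msupp_eq0; case E: msupp => [//|m r].
  have mE : m \in msupp (b0 * f0) by rewrite E mem_head.
  have := v00 m mE.
  have /msuppM_le/allpairsP[[m1 m2] /= [/wpart_supp w1 /wpart_supp w2 ->]] := mE.
  by rewrite wdegD w1 w2 add0n ltnn.
rewrite mulf_eq0 => /orP[] /eqP eq0.
  by case: vb; move: vb1; rewrite eq0 subr0.
by move: vf1; rewrite eq0 subr0.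
Qed.

Definition var_ideal : set (mpoly n K) :=
  ideal_gen [set f | exists2 i, i \in C & f = mpolyX K (mnm1 i)].

Lemma vanish_var_ideal_pow d f : vanish d f -> ideal_pow var_ideal d f.
Proof.
move=> vf; rewrite [f]mpolyE.
have idI : is_ideal (ideal_pow var_ideal d) by exact: ideal_gen_ideal.
apply: ideal_sum => // m /vf; rewrite -mul_mpolyC => dm.
have [_ _] := idI; apply.
elim: d m dm {vf idI} => [|d IH] m dm; first exact: ideal_pow0.
have /wdeg_gt0P[i iC mi] : (0 < wdeg m)%N by exact: leq_trans dm.
have le1m : mpoly.lem (mnm1 i) m.
  by apply/mnm_lepP => j; rewrite mnm1E; case: eqP => // <-.
move: dm; rewrite -(submK le1m) addmC wdegD wdeg1 iC ltnS => dm.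
rewrite mpolyXD; apply: ideal_powS (IH _ dm).
by apply: sub_ideal_gen; exists i.
Qed.

End Vanishing.

(** * Edge ideals and vertex covers *)

Section EdgeIdeal.
Context (K : fieldType) (G : sgraph).
Implicit Types (x y : G) (C : {set G}) (m : multinom #|G|).
Implicit Types (f g : vertex_ring K G).

Let vv x : vertex_ring K G := vertex_var K G x.
Let I : set (vertex_ring K G) := edge_ideal K G.

Definition has_edge m : Prop :=
  exists x y, [/\ edge x y, (0 < m (enum_rank x))%N & (0 < m (enum_rank y))%N].

Lemma edge_ideal_ideal : is_ideal I.
Proof. exact: ideal_gen_ideal. Qed.

Lemma edge_in x y : edge x y -> I (vv x * vv y).
Proof. by move=> xy; apply: sub_ideal_gen; exists x, y. Qed.

Lemma has_edge_addl m1 m2 : has_edge m2 -> has_edge (mnm_add m1 m2).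
Proof.
by case=> x [y [xy mx my]]; exists x, y; rewrite !mnmDE !addn_gt0 mx my !orbT.
Qed.

(** Edge ideals are monomial ideals: membership is decided on the support. *)
Lemma edge_idealP f : I f <-> (forall m, m \in msupp f -> has_edge m).
Proof.
split=> [|mf].
  move: f; apply: (@ideal_gen_min _ _
    (fun f => forall m, m \in msupp (f : mpoly #|G| K) -> has_edge m)).
    split=> [m|f g ef eg m /msuppD_le|g f ef m].
    - by rewrite msupp0.
    - by rewrite mem_cat => /orP[/ef|/eg].
    - move=> /msuppM_le/allpairsP[[m1 m2] /= [_ /ef em ->]].
      exact: has_edge_addl.
  move=> _ [x [y [xy ->]]] m; rewrite /vertex_var -mpolyXD => /mem_msuppXP <-.
  by exists x, y; rewrite !mnmDE !mnm1E !eqxx addn1.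
have idI := edge_ideal_ideal; have [_ _ IM] := idI.
rewrite [f]mpolyE; apply: ideal_sum => // m /mf[x [y [xy mx my]]].
rewrite -mul_mpolyC; apply: (IM).
have le_m : mpoly.lem (mnm_add (mnm1 (enum_rank x)) (mnm1 (enum_rank y))) m.
  apply/mnm_lepP => i; rewrite mnmDE !mnm1E.
  case: eqP => [<-|_]; last by case: eqP => // <-.
  (* The exponents of the two endpoints would add up if they coincided. *)
  case: eqP => [/enum_rank_inj yx|//].
  by move: xy; rewrite yx edge_irrefl.
rewrite -(submK le_m) mpolyXD; apply: (IM).
by rewrite mpolyXD; apply: edge_in.
Qed.

(** Write [P = (I : h)] and take a monomial [m] of [h] outside [I], which exists
    as [P] is proper.  The support of [m] is an independent set, and every
    vertex whose variable is in [P] has a neighbor in it, as the variable times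
    [m] is in [I].  A vertex of the support cannot itself be in [P]: it would
    have a neighbor in the support, against independence. *)
Lemma Ass_neighbor P x : Ass I P -> P (vv x) ->
  exists2 y, edge x y & ~ P (vv y).
Proof.
move=> [pP [h PE]].
have [m mh Nm] : exists2 m, m \in msupp h & ~ has_edge m.
  apply: contrapT => Nh; apply: (prime_ideal1 pP); rewrite PE /= mul1r.
  apply/edge_idealP => m mh; apply: contrapT => Nm; apply: Nh.
  by exists m.
have PX z : P (vv z) -> has_edge (mnm_add (mnm1 (enum_rank z)) m).
  rewrite PE => /edge_idealP; apply.
  by rewrite mulrC mcoeff_msupp mcoeffMX -mcoeff_msupp.
have nbr z : P (vv z) -> exists2 y, edge z y & (0 < m (enum_rank y))%N.
  move=> /PX[u [v []]]; rewrite !mnmDE !mnm1E !(inj_eq enum_rank_inj).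
  have [<-{u} zv _|_] := eqVneq z u.
    case: eqP zv => [<-|_ zv mv]; first by rewrite edge_irrefl.
    by exists v.
  have [<-{v} uz mu _|_ uv mu mv] := eqVneq z v.
    by exists u; rewrite // edge_sym.
  by case: Nm; exists u, v.
move=> /nbr[y xy my]; exists y => // /nbr[z yz mz].
by apply: Nm; exists y, z.
Qed.

Definition cover C := [forall x, forall y, edge x y ==> (x \in C) || (y \in C)].

Lemma coverP C :
  reflect (forall x y, edge x y -> x \in C \/ y \in C) (cover C).
Proof.
apply: (iffP forallP) => [cC x y xy|cC x].
  by have /forallP/(_ y)/implyP/(_ xy)/orP := cC x.
by apply/forallP => y; apply/implyP => /cC/orP.
Qed.

(** A vertex whose neighbors were all in [C] could be removed from [C]. *)
Lemma minimal_coverP C x : minset cover C -> x \in C ->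
  exists2 y, edge x y & y \notin C.
Proof.
move=> /minsetP[/coverP cC minC] xC.
have /coverP NC : ~~ cover (C :\ x).
  apply/negP => /minC/(_ (subD1set _ _)) /setP/(_ x).
  by rewrite xC setD11.
apply: contrapT => Nx; apply: NC => u v uv; rewrite !inE.
have Cx y : edge x y -> y \in C.
  by move=> xy; apply/negP => /negP yC; apply: Nx; exists y.
have [ux|ux] /= := eqVneq u x.
  move: uv; rewrite ux => xv; right; rewrite (Cx _ xv) andbT.
  by apply/eqP => vx; move: xv; rewrite vx edge_irrefl.
have [vx|vx] /= := eqVneq v x; last exact: cC.
by left; apply: Cx; rewrite -vx edge_sym.
Qed.

Definition ranks C : {set 'I_#|G|} := [set enum_rank x | x in C].

Lemma mem_ranks C x : (enum_rank x \in ranks C) = (x \in C).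
Proof. by rewrite mem_imset //; exact: enum_rank_inj. Qed.

(** This single element serves two purposes: it is outside any prime ideal
    whose variables are those of [C], and it moves each variable of [C] that
    has a neighbor outside [C] into the edge ideal. *)
Definition off_prod C : vertex_ring K G := \prod_(y in ~: C) vv y.

Lemma off_prod_edge C x y : edge x y -> y \notin C -> I (vv x * off_prod C).
Proof.
move=> xy yC; have [_ _ IM] := edge_ideal_ideal.
rewrite /off_prod (bigD1 y) ?inE //= mulrA mulrC; apply: IM.
exact: edge_in.
Qed.

Lemma vanish_vertex_var C x : vanish (ranks C) 1 (vv x) <-> x \in C.
Proof.
rewrite -mem_ranks; split=> [/(_ (mnm1 (enum_rank x)))|xC m /mem_msuppXP <-].
  by rewrite msuppX mem_head wdeg1; case: (_ \in _) => // /(_ isT).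
by rewrite wdeg1 xC.
Qed.

Lemma vanish_prime C : is_prime_ideal (vanish (K := K) (ranks C) 1).
Proof.
have [v0 vD vM] := vanish_ideal K (ranks C) 1.
split; first split.
- by rewrite inE.
- apply/negP; rewrite inE => /(_ mnm0).
  by rewrite msupp1 mem_head /wdeg big1 => [/(_ isT)|i] //; rewrite mnm0E.
- by move=> a u v; rewrite !inE => vu vv'; apply: vD => //; apply: vM.
move=> u v; rewrite !inE => vuv; apply/orP.
have [vu|vu] := pselect (vanish (ranks C) 1 u); first by left; rewrite inE.
by right; rewrite inE; apply: vanish_cancel vuv.
Qed.

Lemma edge_ideal_vanish C : cover C -> I `<=` vanish (ranks C) 1.
Proof.
move=> /coverP cC; apply: ideal_gen_min; first exact: vanish_ideal.
have [_ _ vM] := vanish_ideal K (ranks C) 1.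
move=> _ [x [y [/cC[] + ->]]] => /vanish_vertex_var vx; last exact: vM.
by rewrite mulrC; apply: vM.
Qed.

(** Up to the power of [off_prod C], the ideal generated by the variables of [C]
    is contained in the edge ideal, so the same holds for the powers. *)
Lemma vanish_edge_ideal_pow C s f :
  (forall x, x \in C -> exists2 y, edge x y & y \notin C) ->
  vanish (ranks C) s f -> ideal_pow I s (f * off_prod C ^+ s).
Proof.
move=> nbr /vanish_var_ideal_pow; apply: (@ideal_pow_morph _ _ idfun) => a.
have [I0 ID IM] := edge_ideal_ideal.
move: a; apply: (@ideal_gen_min _ _ (fun a => I (a * off_prod C))).
  split=> [|a b Ia Ib|a b Ib]; first by rewrite mul0r.
  - by rewrite mulrDl; apply: ID.
  - by rewrite -mulrA; apply: IM.
move=> _ [_ /imsetP[x xC ->] ->].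
by have [y xy yC] := nbr x xC; apply: off_prod_edge yC.
Qed.

(** The ideal generated by the variables of [C] is [(I : off_prod C)]: one
    inclusion holds since each vertex of [C] has a neighbor outside [C], the
    other since that ideal is prime, contains [I], and misses [off_prod C]. *)
Lemma minimal_cover_Ass C : minset cover C -> Ass I (vanish (ranks C) 1).
Proof.
move=> minC; split; first exact: vanish_prime.
have idI := edge_ideal_ideal.
exists (off_prod C); apply/seteqP; split=> f /= vf.
  apply: (ideal_pow1_sub idI); rewrite -[off_prod C]expr1.
  by apply: vanish_edge_ideal_pow => // x; apply: minimal_coverP.
have NC : ~ vanish (ranks C) 1 (off_prod C).
  apply: (prime_ideal_prod_not (vanish_prime C)) => y.
  by rewrite inE => /negP + /vanish_vertex_var.
apply: (vanish_cancel NC); rewrite mulrC.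
by apply: edge_ideal_vanish vf; case/minsetP: minC.
Qed.

(** The edge ideal vanishes along the subspace of the cover [C], so its [s]-th
    power vanishes to order [s] there, and cancelling a denominator outside the
    prime of [C] keeps the order. *)
Lemma symbolic_pow_vanish C s : minset cover C ->
  symbolic_pow I s `<=` vanish (ranks C) s.
Proof.
move=> minC f /(_ _ (minimal_cover_Ass minC)) /=.
case/local_ext_tofracP; [exact: vanish_prime|exact: ideal_gen_ideal|].
move=> b Nb Ibf; apply: (vanish_cancel Nb); move: (b * f) Ibf.
apply: ideal_pow_min; first exact: vanish_ideal.
move=> a Ia; apply: vanish_prod => i; apply: edge_ideal_vanish (Ia i).
by case/minsetP: minC.
Qed.

End EdgeIdeal.

(** * Passing to an induced subgraph *)

Section InducedSubgraph.
Context (K : fieldType) (G : sgraph) (W : {set G}).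
Let H := induced W.

Definition extend_tuple : #|H|.-tuple (mpoly #|G| K) :=
  [tuple vertex_var K G (val (enum_val j)) | j < #|H|].

Definition extend : {rmorphism vertex_ring K H -> vertex_ring K G} :=
  comp_mpoly extend_tuple.

Definition restrict_tuple : #|G|.-tuple (mpoly #|H| K) :=
  [tuple if insub (enum_val k) is Some x then vertex_var K H x else 0
  | k < #|G|].

Definition restrict : {rmorphism vertex_ring K G -> vertex_ring K H} :=
  comp_mpoly restrict_tuple.

Lemma extend_var (x : H) :
  extend (vertex_var K H x) = vertex_var K G (val x).
Proof.
by rewrite /extend /= comp_mpolyXU -tnth_nth tnth_mktuple enum_rankK.
Qed.

Lemma restrict_var (x : G) :
  restrict (vertex_var K G x) =
  if insub x is Some y then vertex_var K H y else 0.
Proof.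
by rewrite /restrict /= comp_mpolyXU -tnth_nth tnth_mktuple enum_rankK.
Qed.

Lemma extendK : cancel extend restrict.
Proof.
move=> f; rewrite [f in LHS]mpolyE (rmorph_sum extend) (rmorph_sum restrict).
rewrite [RHS]mpolyE; apply: eq_bigr => m _.
rewrite -mul_mpolyC (rmorphM extend) (rmorphM restrict) mpolyXE_id.
rewrite (rmorph_prod extend) (rmorph_prod restrict) /= !comp_mpolyC.
congr (_ * _); apply: eq_bigr => i _.
rewrite (rmorphXn extend) (rmorphXn restrict); congr (_ ^+ _).
have -> : mpolyX K (mnm1 i) = vertex_var K H (enum_val i).
  by rewrite /vertex_var enum_valK.
by rewrite extend_var restrict_var valK.
Qed.

Lemma restrict_edge_ideal f : edge_ideal K G f -> edge_ideal K H (restrict f).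
Proof.
have [I0 ID IM] := edge_ideal_ideal K H.
move: f; apply: (@ideal_gen_min _ _ (fun f => edge_ideal K H (restrict f))).
  split=> [|a b Ia Ib|a b Ib]; first by rewrite rmorph0.
  - by rewrite rmorphD; apply: ID.
  - by rewrite rmorphM; apply: IM.
move=> _ [x [y [xy ->]]]; rewrite rmorphM !restrict_var.
case: insubP => [u _ ux|_]; last by rewrite mul0r.
case: insubP => [v _ vy|_]; last by rewrite mulr0.
by apply: edge_in; rewrite /= /induced_edge ux vy.
Qed.

Lemma restrict_edge_ideal_pow t f :
  ideal_pow (edge_ideal K G) t f -> ideal_pow (edge_ideal K H) t (restrict f).
Proof.
move=> If; rewrite -[restrict f]mulr1 -(expr1n _ t).
by apply: ideal_pow_morph If => a /restrict_edge_ideal; rewrite mulr1.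
Qed.

(** The localization at [P] is reached through a minimal cover [C'] of [H]
    inside the trace [CW] of [C], because the contraction of [P] need not be an
    associated prime of the edge ideal of [H].  The denominator is built from
    the vertices outside [C], as the neighbors that [Ass_neighbor] provides may
    lie outside [W]. *)
Lemma extend_symbolic_pow s f : symbolic_pow (edge_ideal K H) s f ->
  symbolic_pow (edge_ideal K G) s (extend f).
Proof.
move=> If P AP; have pP : is_prime_ideal P by case: AP.
have idI := edge_ideal_ideal K G; have [I0 ID IM] := idI.
apply/local_ext_tofracP => //; first exact: ideal_gen_ideal.
pose C := [set x | `[< P (vertex_var K G x) >]]%SET.
pose CW : {set H} := [set x | val x \in C]%SET.
have coverCW : cover CW.
  apply/coverP => x y xy; rewrite !inE.
  have : P (vertex_var K G (val x) * vertex_var K G (val y)).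
    have [_ [h ->]] := AP; rewrite /= mulrC; apply: IM; exact: edge_in.
  by case/(prime_idealM pP); [left|right].
have [C' minC' sub'] := minset_exists coverCW.
exists (off_prod K C ^+ s).
  apply: (prime_idealX_not pP); apply: (prime_ideal_prod_not pP) => y.
  by rewrite !inE => /asboolP.
rewrite mulrC.
have /vanish_var_ideal_pow := symbolic_pow_vanish minC' If.
apply: ideal_pow_morph => a.
move: a; apply: (@ideal_gen_min _ _
  (fun a => edge_ideal K G (extend a * off_prod K C))).
  split=> [|a b Ia Ib|a b Ib]; first by rewrite rmorph0 mul0r.
  - by rewrite rmorphD mulrDl; apply: ID.
  - by rewrite rmorphM -mulrA; apply: IM.
move=> _ [_ /imsetP[x xC' ->] ->].
have := fintype.subsetP sub' _ xC'; rewrite !inE => /(Ass_neighbor AP)[y xy Py].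
rewrite [extend _]extend_var; apply: off_prod_edge xy _.
by rewrite inE; apply/asboolPn.
Qed.

Lemma induced_containment s t :
  symbolic_pow (edge_ideal K G) s `<=` ideal_pow (edge_ideal K G) t ->
  symbolic_pow (edge_ideal K H) s `<=` ideal_pow (edge_ideal K H) t.
Proof.
move=> sub f /extend_symbolic_pow/sub/restrict_edge_ideal_pow.
by rewrite extendK.
Qed.

End InducedSubgraph.

Theorem proposition5p2 (R : realType) (K : fieldType) (G : sgraph)
  (W : {set G}) (hW : nontrivial (induced W)) :
  (resurgence R (edge_ideal K (induced W))
     <= resurgence R (edge_ideal K G))%E /\
  (asymptotic_resurgence R (edge_ideal K (induced W))
     <= asymptotic_resurgence R (edge_ideal K G))%E.
Proof.
split; apply: ereal_sup_le => _ [s [t [s0 t0 Nst ->]]].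
  by exists s, t; split=> // /induced_containment.
exists s, t; split=> //; have [N Nst'] := Nst.
by exists N => r /Nst' NC /induced_containment.
Qed.
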